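(* Let $\vec b,\vec c\in\mathbb{R}^m$ be any vectors, let $B\in\mathbb{R}^{m\times l_1}$ and $C\in\mathbb{R}^{m\times l_2}$ be fixed matrices, and consider the linear varieties $$V_{\vec b}:=\{\vec b+B\vec u:\ \vec u\in\mathbb{R}^{l_1}\},\qquad V_{\vec c}:=\{\vec c-C\vec v:\ \vec v\in\mathbb{R}^{l_2}\}.$$ Put $\vec d=\vec c-\vec b$ and $n=l_1+l_2$, and assume that $A=[B\ \ C]=[\vec a_1\ \vec a_2\ \cdots\ \vec a_n]\in\mathbb{R}^{m\times n}$ has full column rank. Then: (A) The optimal pair $(\vec b^*,\vec c^{\,*})$ of $V_{\vec b}$ and $V_{\vec c}$ is obtained as $$\vec b^*=\vec b+B\vec u^*,\qquad \vec c^{\,*}=\vec c-C\vec v^*,$$ where $\vec u^*\in\mathbb{R}^{l_1}$ and $\vec v^*\in\mathbb{R}^{l_2}$ are determined by $$A\begin{bmatrix}\vec u^*\\ \vec v^*\end{bmatrix}=-\frac{1}{g(\vec a_1,\vec a_2,\ldots,\vec a_n)}\begin{vmatrix}\vec a_1\bullet\vec a_1&\cdots&\vec a_1\bullet\vec a_n&\vec d\bullet\vec a_1\\ \vdots&&\vdots&\vdots\\ \vec a_n\bullet\vec a_1&\cdots&\vec a_n\bullet\vec a_n&\vec d\bullet\vec a_n\\ \vec a_1&\cdots&\vec a_n&\vec 0\end{vmatrix},$$ the (formal) determinant being expanded along its last row, so that it yields a linear combination of the columns $\vec a_1,\ldots,\vec a_n$ of $A$. (B) The distance between $V_{\vec b}$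 and $V_{\vec c}$ is given by $$d(V_{\vec b},V_{\vec c})=\|\vec b^*-\vec c^{\,*}\|,$$ and also $$d^2(V_{\vec b},V_{\vec c})=\frac{g(\vec d,\vec a_1,\vec a_2,\ldots,\vec a_n)}{g(\vec a_1,\vec a_2,\ldots,\vec a_n)}.$$
   Context: $\mathbb{R}^m$ carries the usual inner product $\vec p\bullet\vec q=p_1q_1+\cdots+p_mq_m$ and the Euclidean norm $\|\vec p\|=\sqrt{\vec p\bullet\vec p}$. For linear varieties $\mathcal A,\mathcal B\subseteq\mathbb{R}^m$, the distance is $d(\mathcal A,\mathcal B)=\inf\{\|\vec a-\vec b\|:\vec a\in\mathcal A,\ \vec b\in\mathcal B\}$; $d^2(\mathcal A,\mathcal B)$ denotes the square of this distance. The optimal pair of $\mathcal A$ and $\mathcal B$ is the pair $(\vec a^*,\vec b^* )\in\mathcal A\times\mathcal B$ satisfying $d(\mathcal A,\mathcal B)=\|\vec a^*-\vec b^*\|$. For $y_1,\ldots,y_k\in\mathbb{R}^m$, the Gram matrix $G(y_1,\ldots,y_k)$ is the $k\times k$ matrix with $(i,j)$ entry $y_i\bullet y_j$, and the Gram determinant is $g(y_1,\ldots,y_k)=\det G(y_1,\ldots,y_k)$. Formal determinant: the displayed $(n+1)\times(n+1)$ array has real scalar entries in its first $n$ rows, and its last row consists of the vectors $\vec a_1,\ldots,\vec a_n,\vec 0\in\mathbb{R}^m$. Its value is the vector of $\mathbb{R}^m$ given by $\sum_{j=1}^{n}(-1)^{n+1+j}M_j\,\vec a_j$, where $M_j$ is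 the determinant of the real $n\times n$ matrix obtained by deleting the last row and the $j$-th column. *)

(* Defs.v *)
From mathcomp Require Import all_boot all_order all_algebra.
From mathcomp Require Import all_classical all_reals.
Set Implicit Arguments.
Unset Strict Implicit.
Unset Printing Implicit Defensive.
Import Order.TTheory GRing.Theory Num.Theory.
Local Open Scope classical_set_scope.
Local Open Scope ring_scope.

Definition dotv (R : realType) (m : nat) (p q : 'cV[R]_m) : R :=
  \sum_i p i 0 * q i 0.

(* MathComp-Analysis equips matrices with the sup norm, so the Euclidean norm
   has to be defined separately. *)
Definition enorm (R : realType) (m : nat) (p : 'cV[R]_m) : R :=
  Num.sqrt (dotv p p).

Definition dist (R : realType) (m : nat) (V W : set 'cV[R]_m) : R :=
  inf [set enorm (v - w) | v in V & w in W].

Definition is_optimal_pair (R : realType) (m : nat) (V W : set 'cV[R]_m)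
    (p : 'cV[R]_m * 'cV[R]_m) : Prop :=
  [/\ V p.1, W p.2 & dist V W = enorm (p.1 - p.2)].

(* The vectors y_1, ..., y_k are the columns of Y. *)
Definition gram (R : realType) (m k : nat) (Y : 'M[R]_(m, k)) : 'M[R]_k :=
  \matrix_(i, j) dotv (col i Y) (col j Y).

Definition gramdet (R : realType) (m k : nat) (Y : 'M[R]_(m, k)) : R :=
  \det (gram Y).

(* The family y_0, ..., y_(n-1), x. *)
Definition append (T : Type) (n : nat) (y : 'I_n -> T) (x : T)
    (j : 'I_n.+1) : T :=
  if unlift ord_max j is Some k then y k else x.

(* Determinant of the (n+1) x (n+1) array with scalar rows S and last row of
   vectors w, expanded along that last row.  Indices start at 0, so that the
   sign (-1)^((n+1) + j) of the 1-based expansion becomes (-1)^(n + j). *)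
Definition formal_det (R : realType) (m n : nat) (S : 'M[R]_(n, n.+1))
    (w : 'I_n.+1 -> 'cV[R]_m) : 'cV[R]_m :=
  \sum_(j < n.+1) ((-1) ^+ (n + j) * \det (col' j S)) *: w j.

Definition bordered_gram_det (R : realType) (m n : nat) (A : 'M[R]_(m, n))
    (d : 'cV[R]_m) : 'cV[R]_m :=
  formal_det
    (\matrix_(i < n, j < n.+1)
       append (fun k : 'I_n => dotv (col i A) (col k A)) (dotv d (col i A)) j)
    (append (fun k : 'I_n => col k A) 0).

(* Main.v *)
(** Write b^* - c^* = A x - d, where x stacks u^* over v^*.  The pair is optimal
    exactly when A x is the orthogonal projection of d onto the column space of
    A, that is, when A^T (A x - d) = 0.  The signed maximal minors of the
    n x (n+1) matrix [A^T A | A^T d] form a vector of its kernel whose last entry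
    is g(A), which identifies the formal determinant with - g(A) A x.  Replacing
    d by the residual d - A x is a column operation of determinant 1, so
    g(d, A) = g(d - A x, A) = |d - A x|^2 g(A). *)

Require Import Defs.
From mathcomp Require Import all_boot all_order all_algebra.
From mathcomp Require Import all_classical all_reals.
From mathcomp Require Import ring.
Set Implicit Arguments.
Unset Strict Implicit.
Unset Printing Implicit Defensive.
Import Order.TTheory GRing.Theory Num.Theory.
Local Open Scope classical_set_scope.
Local Open Scope ring_scope.

Section MinorsVector.
Variables (R : comPzRingType) (n : nat).
Implicit Types S : 'M[R]_(n, n.+1).

(** The generalised cross product of the rows of [S]: its entries are the cofactors along a row
    added below [S]. *)
Definition minors_vec S : 'cV[R]_n.+1 :=
  \col_j ((-1) ^+ (n + j) * \det (col' j S)).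

Lemma mulmx_minors_vec S : S *m minors_vec S = 0.
Proof.
apply/colP => i; rewrite !mxE.
(* T is S bordered below by a copy of its own row i. *)
pose T := \matrix_(k, j) S (odflt i (unlift ord_max k)) j : 'M[R]_n.+1.
transitivity (\det T); last first.
  apply: (@determinant_alternate _ _ T (lift ord_max i) ord_max).
    by rewrite eq_sym neq_lift.
  by move=> j; rewrite !mxE liftK unlift_none.
rewrite (expand_det_row _ ord_max); apply: eq_bigr => j _.
rewrite !mxE unlift_none /cofactor /=; congr (_ * (_ * \det _)).
by apply/matrixP => k l; rewrite !mxE liftK.
Qed.

End MinorsVector.

Section Gram.
Variable R : realType.
Implicit Types m n k : nat.

Lemma dotvE m (p q : 'cV[R]_m) : dotv p q = (p^T *m q) 0 0.
Proof. by rewrite mxE; apply: eq_bigr => i _; rewrite mxE. Qed.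

Lemma dotvv_ge0 m (p : 'cV[R]_m) : 0 <= dotv p p.
Proof. by apply: sumr_ge0 => i _; rewrite -expr2 sqr_ge0. Qed.

Lemma dotvv_eq0 m (p : 'cV[R]_m) : (dotv p p == 0) = (p == 0).
Proof.
apply/idP/eqP => [|->]; last by rewrite dotvE mulmx0 mxE.
rewrite psumr_eq0 => [/allP p0|i _]; last by rewrite -expr2 sqr_ge0.
apply/colP => i; rewrite mxE; apply/eqP.
by have := p0 i (mem_index_enum i); rewrite mulf_eq0 orbb.
Qed.

Lemma dotvvN m (p : 'cV[R]_m) : dotv (- p) (- p) = dotv p p.
Proof. by apply: eq_bigr => i _; rewrite !mxE mulrNN. Qed.

Lemma dotvv_add_orthogonal m (p q : 'cV[R]_m) :
  p^T *m q = 0 -> dotv (p + q) (p + q) = dotv p p + dotv q q.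
Proof.
move=> pq0; have qp0 : q^T *m p = 0 by rewrite -[LHS]trmxK trmx_mul trmxK pq0 trmx0.
by rewrite !dotvE [(p + q)^T]linearD /= mulmxDl !mulmxDr pq0 qp0 addr0 add0r mxE.
Qed.

Lemma sqr_enorm m (p : 'cV[R]_m) : enorm p ^+ 2 = dotv p p.
Proof. by rewrite sqr_sqrtr ?dotvv_ge0. Qed.

Lemma gramE m n (A : 'M[R]_(m, n)) : gram A = A^T *m A.
Proof. by apply/matrixP => i j; rewrite !mxE; apply: eq_bigr => k _; rewrite !mxE. Qed.

(** If [v *m A^T *m A = 0], then [A *m v^T] has squared norm 0, so [v] vanishes by full column
    rank. *)
Lemma gram_unitmx m n (A : 'M[R]_(m, n)) : \rank A = n -> gram A \in unitmx.
Proof.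
move=> rankA; rewrite -row_free_unit; apply: inj_row_free => v.
rewrite gramE mulmxA => vAA0.
have : dotv (A *m v^T) (A *m v^T) == 0.
  by rewrite dotvE trmx_mul trmxK mulmxA vAA0 mul0mx mxE.
rewrite dotvv_eq0 => /eqP Av0; apply/eqP.
have freeAT : row_free A^T by rewrite /row_free mxrank_tr rankA.
by rewrite -(mulmx_free_eq0 v freeAT) -[_ *m _]trmxK trmx_mul trmxK Av0 trmx0.
Qed.

Lemma gram_col_inj m n p (A : 'M[R]_(m, n)) (X Y : 'M[R]_(n, p)) :
  \rank A = n -> A *m X = A *m Y -> X = Y.
Proof.
move=> /gram_unitmx; rewrite gramE => Gu AXY.
by rewrite -[X](mulKmx Gu) -[Y](mulKmx Gu) -!mulmxA AXY.
Qed.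

Lemma gramdet_mulmx m n (A : 'M[R]_(m, n)) (U : 'M[R]_n) :
  gramdet (A *m U) = \det U ^+ 2 * gramdet A.
Proof.
rewrite /gramdet !gramE trmx_mul mulmxA -(mulmxA U^T) !det_mulmx det_tr.
by rewrite mulrAC expr2.
Qed.

(** Orthogonality makes the Gram matrix block diagonal, with blocks [r^T *m r] and [A^T *m A]. *)
Lemma gramdet_orthogonal m n (A : 'M[R]_(m, n)) (r : 'cV[R]_m) :
  A^T *m r = 0 -> gramdet (row_mx r A) = dotv r r * gramdet A.
Proof.
move=> Ar0; have rA0 : r^T *m A = 0 by rewrite -[LHS]trmxK trmx_mul trmxK Ar0 trmx0.
rewrite /gramdet !gramE tr_row_mx mul_col_row Ar0 rA0 det_ublock.
by rewrite det_mx11 dotvE.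
Qed.

Lemma gramdet_sub_col m n (A : 'M[R]_(m, n)) (d : 'cV[R]_m) (x : 'cV[R]_n) :
  gramdet (row_mx (d - A *m x) A) = gramdet (row_mx d A).
Proof.
have -> : row_mx (d - A *m x) A = row_mx d A *m block_mx 1%:M 0 (- x) 1%:M.
  by rewrite mul_row_block !mulmx1 mulmx0 add0r mulmxN.
by rewrite gramdet_mulmx det_lblock !det1 mulr1 expr1n mul1r.
Qed.

Lemma bordered_gram_detE m n (A : 'M[R]_(m, n)) (d : 'cV[R]_m) (x : 'cV[R]_n) :
  \rank A = n -> A^T *m (d - A *m x) = 0 ->
  bordered_gram_det A d = - gramdet A *: (A *m x).
Proof.
move=> rankA normal.
rewrite /bordered_gram_det; set S := \matrix_(i, j) _.
have S_lift (i k : 'I_n) : S i (lift ord_max k) = gram A i k.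
  by rewrite !mxE /append liftK.
(* By the normal equations, the last column [A^T *m d] equals [gram A *m x]. *)
have S_max i : S i ord_max = (gram A *m x) i 0.
  rewrite mxE /append unlift_none gramE -mulmxA.
  move/eqP: normal; rewrite mulmxBr subr_eq0 => /eqP <-.
  by rewrite mxE; apply: eq_bigr => k _; rewrite !mxE mulrC.
pose w := \col_(k < n) minors_vec S (lift ord_max k) 0.
have w_max : minors_vec S ord_max 0 = gramdet A.
  rewrite mxE addnn -mul2n exprM sqrrN !expr1n mul1r; congr (\det _).
  by apply/matrixP => i k; rewrite mxE S_lift.
(* The last vector of the bottom row is 0, so the last minor drops out of the expansion. *)
have -> : formal_det S (append (fun k : 'I_n => col k A) 0) = A *m w.
  apply/colP => i; rewrite summxE (bigD1_ord ord_max) //= mxE.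
  rewrite /append unlift_none mxE mulr0 add0r mxE.
  by apply: eq_bigr => k _; rewrite liftK !mxE mulrC.
suff -> : w = - gramdet A *: x by rewrite scalemxAr.
(* After multiplication by the invertible Gram matrix, the claim is row by row the kernel relation
   of [S], with its last term moved to the other side. *)
rewrite -[LHS](mulKmx (gram_unitmx rankA)) -[RHS](mulKmx (gram_unitmx rankA)).
congr (_ *m _); apply/colP => i; rewrite -scalemxAr.
have /colP/(_ i)/eqP := mulmx_minors_vec S.
rewrite mxE (bigD1_ord ord_max) //= w_max S_max [X in _ == X]mxE addrC addr_eq0.
rewrite [RHS]mxE mulNr mulrC => /eqP <-.
by rewrite mxE; apply: eq_bigr => k _; rewrite S_lift [w _ _]mxE.
Qed.

End Gram.

Theorem proposition2p3 (R : realType) (m l1 l2 : nat) (b c : 'cV[R]_m)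
    (B : 'M[R]_(m, l1)) (C : 'M[R]_(m, l2))
    (rankA : \rank (row_mx B C) = (l1 + l2)%N) :
  let A : 'M[R]_(m, l1 + l2) := row_mx B C in
  let d : 'cV[R]_m := c - b in
  let Vb : set 'cV[R]_m := [set b + B *m u | u in [set: 'cV[R]_l1]] in
  let Vc : set 'cV[R]_m := [set c - C *m v | v in [set: 'cV[R]_l2]] in
  exists (us : 'cV[R]_l1) (vs : 'cV[R]_l2),
    let bs : 'cV[R]_m := b + B *m us in
    let cs : 'cV[R]_m := c - C *m vs in
    [/\ A *m col_mx us vs = - (1 / gramdet A) *: bordered_gram_det A d
          /\ (forall (u : 'cV[R]_l1) (v : 'cV[R]_l2),
                A *m col_mx u v = - (1 / gramdet A) *: bordered_gram_det A d ->
                u = us /\ v = vs),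
        is_optimal_pair Vb Vc (bs, cs)
          /\ (forall p : 'cV[R]_m * 'cV[R]_m,
                is_optimal_pair Vb Vc p -> p = (bs, cs)),
        dist Vb Vc = enorm (bs - cs)
      & dist Vb Vc ^+ 2 = gramdet (row_mx d A) / gramdet A].
Proof.
move=> A d Vb Vc.
have Gu : A^T *m A \in unitmx by rewrite -gramE gram_unitmx.
pose x : 'cV[R]_(l1 + l2) := invmx (A^T *m A) *m (A^T *m d).
have normal : A^T *m (d - A *m x) = 0.
  by rewrite mulmxBr [_ *m (A *m x)]mulmxA mulKVmx ?subrr.
have g_neq0 : gramdet A != 0.
  by rewrite -unitfE -unitmxE gram_unitmx.
have bordered : - (1 / gramdet A) *: bordered_gram_det A d = A *m x.
  rewrite (bordered_gram_detE rankA normal) scalerA mulrNN mul1r.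
  by rewrite mulVf ?scale1r.
have diffE u v : (b + B *m u) - (c - C *m v) = A *m col_mx u v - d.
  by rewrite mul_row_col /d !opprB !addrA; apply/colP => i; rewrite !mxE; ring.
(* [A *m x - d] is orthogonal to the column space of [A], which contains [A *m (y - x)]. *)
have pythagoras y : dotv (A *m y - d) (A *m y - d) =
    dotv (A *m (y - x)) (A *m (y - x)) + dotv (A *m x - d) (A *m x - d).
  rewrite -dotvv_add_orthogonal; first by rewrite mulmxBr subrKA.
  by rewrite trmx_mul -mulmxA -[_ - d]opprB mulmxN normal oppr0 mulmx0.
pose us := usubmx x; pose vs := dsubmx x.
have xE : col_mx us vs = x by rewrite vsubmxK.
have distE : dist Vb Vc = enorm (A *m x - d).
  have lbV : lbound [set enorm (v - w) | v in Vb & w in Vc] (enorm (A *m x - d)).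
    move=> _ [_ [u _ <-] [_ [v _ <-] <-]].
    by rewrite diffE ler_sqrt ?dotvv_ge0 // (pythagoras (col_mx u v)) lerDr dotvv_ge0.
  have inV : [set enorm (v - w) | v in Vb & w in Vc] (enorm (A *m x - d)).
    exists (b + B *m us); first by exists us.
    by exists (c - C *m vs); [exists vs | rewrite diffE xE].
  (* A lower bound that belongs to the set is its infimum. *)
  apply/le_anti/andP; split.
    by apply: ge_inf => //; exists (enorm (A *m x - d)).
  by apply: lb_le_inf => //; exists (enorm (A *m x - d)).
exists us, vs => bs cs.
have distbc : dist Vb Vc = enorm (bs - cs) by rewrite diffE xE.
split=> //.
- split=> [|u v]; rewrite bordered; first by rewrite xE.
  by rewrite -xE => /(gram_col_inj rankA)/eq_col_mx.
- split; first by split=> //; [exists us | exists vs].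
  move=> [_ _] [/= [u _ <-] [v _ <-]].
  rewrite distE diffE => /(congr1 (fun t => t ^+ 2)).
  (* Equal distances force the first Pythagorean term to vanish, and injectivity of [A] then
     identifies [u] and [v]. *)
  rewrite !sqr_enorm (pythagoras (col_mx u v)) -[LHS]add0r => /addIr/esym/eqP.
  rewrite dotvv_eq0 mulmxBr subr_eq0 -xE => /eqP/(gram_col_inj rankA).
  by move=> /eq_col_mx[-> ->].
(* The numerator becomes the squared norm of the residual times [gramdet A], which cancels. *)
- rewrite distE sqr_enorm -(gramdet_sub_col A d x) (gramdet_orthogonal normal).
  by rewrite mulfK // -dotvvN opprB.
Qed.
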